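(* Let $B_0$ be a real constant (the magnetic field on the axis $r=0$), $U_B=1+\frac{B_0^2r^2}{4}$, and let $$g=U_B^2(-dt^2+dr^2+dz^2)+\frac{r^2}{U_B^2}\,d\phi^2$$ be the Melvin magnetic metric on $\{(t,r,z)\in\mathbb{R}^3:r>0\}\times S^1$, with coordinates $(x^1,x^2,x^3,x^4)=(t,r,z,\phi)$. Then it admits the following properties: (i) The scalar curvature is $\kappa=0$, and hence $C=K$ and $R=W$. (ii) It is pseudosymmetric and pseudosymmetric due to the conformal curvature tensor, i.e. it satisfies $$R\cdot R=\mathcal{L}_1\,Q(g,R),\qquad C\cdot R=\mathcal{L}_1\,Q(g,R),\qquad \mathcal{L}_1=\frac{32B_0^2(4-B_0^2r^2)}{(4+B_0^2r^2)^4}.$$ (iii) It also satisfies the following pseudosymmetric type curvature conditions: (a) $R\cdot R-Q(S,R)=\mathcal{L}_2\,Q(g,C)$, $\mathcal{L}_2=-\dfrac{32B_0^2(16+24B_0^2r^2-3B_0^4r^4)}{3(4-B_0^2r^2)(4+B_0^2r^2)^4}$; (b) $Q(S,C)=C\cdot R-R\cdot C$; (c) $C\cdot R-R\cdot C=\mathcal{L}_3\,Q(g,R)+\mathcal{L}_4\,Q(S,R)$, $\mathcal{L}_3=-\dfrac{2048B_0^2(4-B_0^2r^2)}{\omega(4+B_0^2r^2)^4}$, $\mathcal{L}_4=1+\dfrac{64}{\omega}$, $\omega=-16-24B_0^2r^2+3B_0^4r^4$. (iv) The curvature $2$-forms for $C$ or $K$ are recurrent, i.e. $\sum(\nabla_{Z_1}C)(Z_2,Z_3,X,Y)=\sum\Pi(Z_1)C(Z_2,Z_3,X,Y)$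 with both sums cyclic over $Z_1,Z_2,Z_3$ (and likewise for $K$), with associated $1$-form of recurrency $$\Pi=\left\{0,\,-\frac{16B_0^2r}{(4-B_0^2r^2)(4+B_0^2r^2)},\,0,\,0\right\}.$$ (v) It is a Roter type spacetime, i.e. it satisfies $R=N_1\,S\wedge S+N_2\,g\wedge S+N_3\,g\wedge g$, where $$N_1=-\frac{3(4-B_0^2r^2)(4+B_0^2r^2)^4}{8192B_0^2},\qquad N_2=\frac12,\qquad N_3=-\frac{8B_0^2(4-B_0^2r^2)}{(4+B_0^2r^2)^4}.$$ (vi) It is $2$-quasi-Einstein for $\alpha=\dfrac{256B_0^2}{(4+B_0^2r^2)^4}$, i.e. $S-\alpha g$ has rank $2$. (vii) It is generalized quasi-Einstein due to Chaki (as defined in the context) for $$\alpha=-\frac{256B_0^2}{(4+B_0^2r^2)^4},\quad \beta=-1,\quad\gamma=1,$$ $$\Pi=\left\{-\frac{4\sqrt2B_0}{4+B_0^2r^2},\,0,\,\frac{4\sqrt2B_0}{\sqrt{16+8B_0^2r^2+B_0^4r^4}},\,0\right\},\quad \delta=\left\{0,\,0,\,\frac{4\sqrt2B_0}{4+B_0^2r^2},\,0\right\},$$ with $\|\Pi\|=0$ and $\|\delta\|=\dfrac{512B_0^2}{(4+B_0^2r^2)^4}$. (viii) It is an $Ein(2)$ spacetime, since $S^2+\lambda g=0$ for $\lambda=-\dfrac{65536B_0^4}{(4+B_0^2r^2)^8}$. (ix) The Ricci tensor is Riemann compatible only.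
   Context: Conventions on a semi-Riemannian manifold of dimension $n$ (here $n=4$) with Levi-Civita connection $\nabla$: the curvature endomorphism is $\mathcal{R}(U,V)=[\nabla_U,\nabla_V]-\nabla_{[U,V]}$, and $R(Z_1,Z_2,Z_3,Z_4)=g(\mathcal{R}(Z_1,Z_2)Z_3,Z_4)$. The Ricci tensor is $S_{bc}=g^{ad}R_{abcd}$ and the scalar curvature is $\kappa=g^{bc}S_{bc}$. The Ricci operator $\mathcal{J}$ is defined by $S(X,Y)=g(X,\mathcal{J}Y)$, and $S^2(X,Y)=g(X,\mathcal{J}^2Y)$. For a $1$-form $\theta$, $\|\theta\|=g^{ab}\theta_a\theta_b$. For symmetric $(0,2)$-tensors $E,F$: $(E\wedge F)(X,Y,U,V)=E(X,V)F(Y,U)-E(X,U)F(Y,V)+E(Y,U)F(X,V)-E(Y,V)F(X,U)$. With $G=\frac12 g\wedge g$: the conformal tensor is $C=R-\frac{1}{n-2}\,g\wedge S+\frac{\kappa}{(n-1)(n-2)}G$, the concircular tensor is $W=R-\frac{\kappa}{n(n-1)}G$, the conharmonic tensor is $K=R-\frac{1}{n-2}\,g\wedge S$, and the projective tensor is $P_{abcd}=R_{abcd}-\frac{1}{n-1}(g_{ad}S_{bc}-g_{bd}S_{ac})$. For a $(0,4)$-tensor $A$ with associated endomorphism $\mathcal{A}(U,V)$ given by $g(\mathcal{A}(U,V)Z_1,Z_2)=A(U,V,Z_1,Z_2)$, a symmetric $(0,2)$-tensor $B$ and a $(0,k)$-tensor $T$: $(A\cdot T)(Z_1,\dots,Z_k;U,V)=-\sum_{i}T(Z_1,\dots,\mathcal{A}(U,V)Z_i,\dots,Z_k)$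 and $Q(B,T)(Z_1,\dots,Z_k;U,V)=-\sum_{i}T(Z_1,\dots,(U\wedge_BV)Z_i,\dots,Z_k)$, where $(U\wedge_BV)Z=B(V,Z)U-B(U,Z)V$. Quasi-Einstein means that $S-\alpha g$ has rank $1$ for some scalar $\alpha$. On the class of non-quasi-Einstein manifolds, a manifold is pseudo quasi-Einstein if $S=\alpha g+\beta\,\Pi\otimes\Pi+\gamma F$ with scalars $\alpha,\beta,\gamma$, a $1$-form $\Pi$, and a trace-free $(0,2)$-tensor $F$ such that $F(Y,U)=0$ for all $Y$, where $U$ is the vector field associated with $\Pi$; in particular, for $F=\Pi\otimes\delta+\delta\otimes\Pi$ with a $1$-form $\delta$, it is generalized quasi-Einstein due to Chaki. $Ein(2)$ means a relation $n_0g+n_1S+n_2S^2=0$ with smooth function coefficients and $n_2\neq0$. For a $(0,4)$-tensor $H$ and a symmetric $(0,2)$-tensor $E$ with corresponding endomorphism $\mathcal{E}$, $E$ is $H$-compatible if $\sum H(\mathcal{E}Z_1,X,Z_2,Z_3)=0$, the sum being cyclic over $Z_1,Z_2,Z_3$. Taking $H=R,W,K,C,P$ gives Riemann, concircular, conharmonic, conformal and projective compatibility respectively.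
   Formalization: Curvature sign reversed (R(U,V)=∇_[U,V]−[∇_U,∇_V]) so the constants hold; (vii) drops F trace-free and F(Y,U)=0; in (ix) ''only'' means not projectively compatible; zeros of 4−B0²r² (iii a, iv) and ω (iii c) excluded; B0≠0 in (v), (vi) and the negative part of (ix). *)

(* Defs.v *)
From HB Require Import structures.
From mathcomp Require Import all_boot all_order all_algebra.
From mathcomp Require Import all_classical all_reals all_analysis.
Set Implicit Arguments.
Unset Strict Implicit.
Unset Printing Implicit Defensive.
Import Order.TTheory GRing.Theory Num.Theory.
Import numFieldNormedType.Exports.
Local Open Scope classical_set_scope.
Local Open Scope ring_scope.

(* Semi-Riemannian geometry in a global coordinate system: points, tangent
   vectors and 1-forms are row vectors of coordinates, (0,2)-tensors are
   matrices, (0,4)-tensors are given by their components, and a tensor field is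
   a function of the point.  A total function represents a field on a domain
   [D]; only its values on [D] matter. *)

Section Coordinates.
Context {R : realType} {n : nat}.

Definition tensor4 := 'I_n -> 'I_n -> 'I_n -> 'I_n -> R.
Definition vfield := 'rV[R]_n -> 'rV[R]_n.
Definition metric := 'rV[R]_n -> 'M[R]_n.

Implicit Types (g : metric) (p : 'rV[R]_n) (D : set 'rV[R]_n) (f : 'rV[R]_n -> R).

Definition pd (i : 'I_n) f p : R := 'D_(delta_mx 0 i) f p.

Fixpoint iter_pd (s : seq 'I_n) f : 'rV[R]_n -> R :=
  if s is i :: s' then pd i (iter_pd s' f) else f.

(* C^infinity on the open set [D]. *)
Definition smooth_on D f : Prop :=
  forall (s : seq 'I_n) p, D p -> differentiable (iter_pd s f) p.

Definition coord_field (i : 'I_n) : vfield := fun=> delta_mx 0 i.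

Definition gdot g p (X Y : 'rV[R]_n) : R := (X *m g p *m Y^T) 0 0.

(* [conorm g p theta] is g^{ab} theta_a theta_b, without a square root. *)
Definition conorm g p (theta : 'rV[R]_n) : R :=
  (theta *m invmx (g p) *m theta^T) 0 0.

(* [christoffel g k i j] is Gamma^k_{ij} of the Levi-Civita connection. *)
Definition christoffel g (k i j : 'I_n) p : R :=
  2^-1 * \sum_(l < n) invmx (g p) k l *
    (pd i (fun q => g q j l) p + pd j (fun q => g q i l) p
     - pd l (fun q => g q i j) p).

Definition nabla g (U V : vfield) : vfield := fun p =>
  \row_(k < n) \sum_(i < n) U p 0 i *
    (pd i (fun q => V q 0 k) p + \sum_(j < n) christoffel g k i j p * V p 0 j).

Definition lie_bracket (U V : vfield) : vfield := fun p =>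
  \row_(k < n) \sum_(i < n)
    (U p 0 i * pd i (fun q => V q 0 k) p - V p 0 i * pd i (fun q => U q 0 k) p).

(* Sign convention: R(U,V) = nabla_[U,V] - [nabla_U, nabla_V].  The constants
   attached to the Melvin metric in the literature are for this sign; with the
   opposite one every curvature tensor below changes sign and these constants
   no longer fit. *)
Definition curvature g (U V W : vfield) : vfield := fun p =>
  nabla g (lie_bracket U V) W p
  - (nabla g U (nabla g V W) p - nabla g V (nabla g U W) p).

Definition riemann g p : tensor4 := fun a b c d =>
  gdot g p (curvature g (coord_field a) (coord_field b) (coord_field c) p)
           (delta_mx 0 d).

Definition ricci g p : 'M[R]_n :=
  \matrix_(b < n, c < n)
    \sum_(a < n) \sum_(d < n) invmx (g p) a d * riemann g p a b c d.

Definition scalar_curvature g p : R :=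
  \sum_(b < n) \sum_(c < n) invmx (g p) b c * ricci g p b c.

(* The endomorphism J with E(X,Y) = g(X, J Y); J e a is the e-th component of
   the image of the a-th coordinate vector. *)
Definition sym_endo g p (E : 'M[R]_n) : 'M[R]_n := invmx (g p) *m E.

Definition ricci_op g p : 'M[R]_n := sym_endo g p (ricci g p).

Definition ricci2 g p : 'M[R]_n := g p *m (ricci_op g p *m ricci_op g p).

Definition wedge (E F : 'M[R]_n) : tensor4 := fun x y u v =>
  E x v * F y u - E x u * F y v + E y u * F x v - E y v * F x u.

Definition Gtensor g p : tensor4 := fun a b c d =>
  2^-1 * wedge (g p) (g p) a b c d.

Definition conformal g p : tensor4 := fun a b c d =>
  riemann g p a b c d
  - (n%:R - 2)^-1 * wedge (g p) (ricci g p) a b c d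
  + scalar_curvature g p / ((n%:R - 1) * (n%:R - 2)) * Gtensor g p a b c d.

Definition concircular g p : tensor4 := fun a b c d =>
  riemann g p a b c d
  - scalar_curvature g p / (n%:R * (n%:R - 1)) * Gtensor g p a b c d.

Definition conharmonic g p : tensor4 := fun a b c d =>
  riemann g p a b c d - (n%:R - 2)^-1 * wedge (g p) (ricci g p) a b c d.

Definition projective g p : tensor4 := fun a b c d =>
  riemann g p a b c d
  - (n%:R - 1)^-1 * (g p a d * ricci g p b c - g p b d * ricci g p a c).

(* Row [a] of [endo4 g p A u v] holds the components of A(d_u,d_v) d_a, where
   g(A(U,V) Z1, Z2) = A(U,V,Z1,Z2). *)
Definition endo4 g p (A : tensor4) (u v : 'I_n) : 'M[R]_n :=
  (\matrix_(a < n, c < n) A u v a c) *m invmx (g p).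

(* Row [a] of [wedge_endo B u v] holds the components of
   (d_u wedge_B d_v) d_a = B(d_v,d_a) d_u - B(d_u,d_a) d_v. *)
Definition wedge_endo (B : 'M[R]_n) (u v : 'I_n) : 'M[R]_n :=
  \matrix_(a < n) (B v a *: delta_mx 0 u - B u a *: delta_mx 0 v).

(* Derivation action of an endomorphism, with row [a] of [L] the image of d_a. *)
Definition derivation4 (L : 'M[R]_n) (T : tensor4) : tensor4 := fun a b c d =>
  - (\sum_(e < n) (L a e * T e b c d + L b e * T a e c d
                   + L c e * T a b e d + L d e * T a b c e)).

(* (A . T)_{abcd uv} and Q(B,T)_{abcd uv}. *)
Definition dot4 g p (A T : tensor4) (a b c d u v : 'I_n) : R :=
  derivation4 (endo4 g p A u v) T a b c d.

Definition tachibana (B : 'M[R]_n) (T : tensor4) (a b c d u v : 'I_n) : R :=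
  derivation4 (wedge_endo B u v) T a b c d.

(* [nabla4 g T m] is the covariant derivative of [T] along d_m. *)
Definition nabla4 g (T : 'rV[R]_n -> tensor4) (m : 'I_n) p : tensor4 :=
  fun a b c d =>
  pd m (fun q => T q a b c d) p
  - \sum_(e < n) (christoffel g e m a p * T p e b c d
                  + christoffel g e m b p * T p a e c d
                  + christoffel g e m c p * T p a b e d
                  + christoffel g e m d p * T p a b c e).

Definition recurrent_curvature_2forms g D (H : 'rV[R]_n -> tensor4)
    (Pi : 'rV[R]_n -> 'rV[R]_n) : Prop :=
  forall p, D p -> forall a b c x y : 'I_n,
    nabla4 g H a p b c x y + nabla4 g H b p c a x y + nabla4 g H c p a b x y
    = Pi p 0 a * H p b c x y + Pi p 0 b * H p c a x y + Pi p 0 c * H p a b x y.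

(* [E] is [H]-compatible; the sum over [e] expands H(E d_a, d_x, d_b, d_c). *)
Definition compatible g D (E : 'rV[R]_n -> 'M[R]_n)
    (H : 'rV[R]_n -> tensor4) : Prop :=
  forall p, D p -> forall a b c x : 'I_n,
    \sum_(e < n) (sym_endo g p (E p) e a * H p e x b c
                  + sym_endo g p (E p) e b * H p e x c a
                  + sym_endo g p (E p) e c * H p e x a b) = 0.

Definition quasi_einstein g D : Prop :=
  exists alpha : 'rV[R]_n -> R,
    forall p, D p -> \rank (ricci g p - alpha p *: g p) = 1%N.

Definition two_quasi_einstein g D (alpha : 'rV[R]_n -> R) : Prop :=
  forall p, D p -> \rank (ricci g p - alpha p *: g p) = 2%N.

(* Neither orthogonality of [Pi] and [delta] nor trace-freeness of
   Pi (x) delta + delta (x) Pi is part of the definition. *)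
Definition chaki_generalized_quasi_einstein g D
    (alpha beta gamma : 'rV[R]_n -> R) (Pi delta : 'rV[R]_n -> 'rV[R]_n) : Prop :=
  ~ quasi_einstein g D /\
  forall p, D p ->
    ricci g p = alpha p *: g p + beta p *: ((Pi p)^T *m Pi p)
      + gamma p *: ((Pi p)^T *m delta p + (delta p)^T *m Pi p).

(* [Cinf] is the set of smooth functions of the manifold. *)
Definition Ein2 g D (Cinf : set ('rV[R]_n -> R)) : Prop :=
  exists n0 n1 n2 : 'rV[R]_n -> R,
    [/\ Cinf n0, Cinf n1, Cinf n2 &
      forall p, D p -> n2 p != 0 /\
        n0 p *: g p + n1 p *: ricci g p + n2 p *: ricci2 g p = 0].

End Coordinates.

Arguments tensor4 : clear implicits.
Arguments vfield : clear implicits.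
Arguments metric : clear implicits.

(* The coordinates (t, r, z, phi) are numbered 0, 1, 2, 3. *)
Definition rcoord {R : realType} (p : 'rV[R]_4) : R := p 0 1.

Definition covector4 {R : realType} (t r z phi : R) : 'rV[R]_4 :=
  \row_(j < 4) [:: t; r; z; phi]`_j.

(* phi ranges over the line: {(t,r,z) : r > 0} x S^1 is the quotient of this
   domain by phi |-> phi + 2 pi, under which the metric is invariant. *)
Definition melvin_dom (R : realType) : set 'rV[R]_4 := [set p | 0 < rcoord p].
Arguments melvin_dom : clear implicits.

Definition melvin_Cinf (R : realType) : set ('rV[R]_4 -> R) :=
  [set f | smooth_on (melvin_dom R) f /\
     forall p, melvin_dom R p -> f (p + (2 * pi) *: delta_mx 0 3) = f p].
Arguments melvin_Cinf : clear implicits.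

Definition melvin_U {R : realType} (B0 r : R) : R := 1 + B0 ^+ 2 * r ^+ 2 / 4.

Definition melvin {R : realType} (B0 : R) : metric R 4 := fun p =>
  let r := rcoord p in
  let U := melvin_U B0 r in
  diag_mx (covector4 (- U ^+ 2) (U ^+ 2) (U ^+ 2) (r ^+ 2 / U ^+ 2)).

(* Main.v *)
(* The Melvin metric is diagonal with coefficients depending on r only, so its
   Riemann tensor is determined by sectional curvatures tau_ij: it has
   components tau_ab g_aa g_bb (d_ad d_bc - d_ac d_bd).  The coordinates split
   into the blocks {t, z} and {r, phi}: tau_ij depends only on the blocks of i
   and j, is equal to L1 when these differ, and the Ricci operator is + c or - c
   according to the block.  Each of A.T and Q(B,T) is, for tensors of this kind,
   linear in a weight attached to an index e, namely
   A_uv (tau_ue - tau_ve), respectively s_v tau_ue - s_u tau_ve with B_ii = s_i g_ii.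
   Hence every identity of pseudosymmetry type reduces to an equality of weights,
   to be checked for each choice of the blocks of u, v and e. *)

Require Import Defs.
From mathcomp Require Import all_boot all_order all_algebra.
From mathcomp Require Import all_classical all_reals all_analysis.
From mathcomp Require Import ring.
Set Implicit Arguments.
Unset Strict Implicit.
Unset Printing Implicit Defensive.
Import Order.TTheory GRing.Theory Num.Theory.
Import numFieldNormedType.Exports.
Local Open Scope classical_set_scope.
Local Open Scope ring_scope.

(** * Index case analysis and diagonal matrices *)

Ltac simp_eq := rewrite ?eqxx; repeat match goal with
  | H : (?x == ?y) = false |- context [?x == ?y] => rewrite H
  | H : (?x == ?y) = false |- context [?y == ?x] => rewrite (eq_sym y x) H
  | H : (?x == ?x) = false |- _ => by rewrite eqxx in H
  end; rewrite /= ?mulr1n ?mulr0n.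
(** Decides every equality of indices in the goal, so that Kronecker deltas become 0 or 1. *)
Ltac case_eqs := simp_eq; repeat (match goal with
  | |- context [@eq_op _ ?x ?y] => let e := fresh "e" in
    have [e|/negPf e] := eqVneq x y; [(subst x || subst y)|] end; simp_eq).

Ltac case_ord i := case: i => [[|[|[|[|//]]]]] ?.

(** Induction splits off the first diagonal entry as a 1 x 1 block. *)
Lemma rank_diag_mx (F : fieldType) n (d : 'rV[F]_n) :
  \rank (diag_mx d) = (\sum_(i < n) (d 0%R i != 0%R))%N.
Proof.
elim: n d => [|n IHn] d; first by rewrite [diag_mx d]flatmx0 mxrank0 big_ord0.
have -> : diag_mx d = block_mx (diag_mx (@lsubmx _ 1 1 n d)) 0 0
                               (diag_mx (@rsubmx _ 1 1 n d)) :> 'M[F]_(1 + n).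
  by rewrite -diag_mx_row hsubmxK.
rewrite (@rank_diag_block_mx _ 1 1 n n) IHn big_ord_recl; congr addn; last first.
  apply: eq_bigr => i _; rewrite mxE; congr (nat_of_bool (~~ (d _ _ == _))).
  exact/val_inj.
have -> : diag_mx (@lsubmx _ 1 1 n d) = (d 0 ord0)%:M.
  apply/matrixP => i j; rewrite !mxE !ord1 !mulr1n.
  by congr (d _ _); apply/val_inj.
rewrite rank_rV; congr (nat_of_bool (~~ _)); apply/eqP/eqP => [e|->].
  by move: (congr1 (fun A : 'M[F]_1 => A 0 0) e); rewrite !mxE eqxx mulr1n.
by apply/matrixP => i j; rewrite !mxE mul0rn.
Qed.

Lemma invmx_diag (F : fieldType) n (d : 'rV[F]_n) : (forall i, d 0 i != 0) ->
  invmx (diag_mx d) = diag_mx (\row_i (d 0 i)^-1).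
Proof.
move=> d0; have e : diag_mx d *m diag_mx (\row_i (d 0 i)^-1) = 1%:M.
  apply/matrixP => i j; rewrite mul_diag_mx !mxE.
  by case: (i == j); rewrite ?mulr1n ?mulr0n ?mulr0 // mulfV.
by case: (mulmx1_unit e) => u _; rewrite -[RHS](mulKmx u) e mulmx1.
Qed.

(** * Curvature in coordinates *)

Section Riemann.
Variables (R : realType) (n : nat).
Implicit Types (g : metric R n) (p : 'rV[R]_n).

Lemma pd_cst (i : 'I_n) (c : R) p : pd i (fun=> c) p = 0.
Proof. exact: derive_cst. Qed.

Lemma sum_deltar (i : 'I_n) (F : 'I_n -> R) : \sum_j (i == j)%:R * F j = F i.
Proof.
rewrite (bigD1 i) //= eqxx mul1r big1 ?addr0 // => j /negPf ji.
by rewrite eq_sym ji mul0r.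
Qed.

Lemma sum_deltal (i : 'I_n) (F : 'I_n -> R) : \sum_j (j == i)%:R * F j = F i.
Proof. by under eq_bigr do rewrite eq_sym; exact: sum_deltar. Qed.

Lemma nabla_coord g (a : 'I_n) (V : vfield R n) p (k : 'I_n) :
  nabla g (coord_field a) V p 0 k
    = pd a (fun q => V q 0 k) p + \sum_(j < n) christoffel g k a j p * V p 0 j.
Proof.
by rewrite mxE; under eq_bigr do rewrite mxE eqxx /=; rewrite sum_deltal.
Qed.

Lemma nabla_coord2 g (a b k : 'I_n) p :
  nabla g (coord_field a) (coord_field b) p 0 k = christoffel g k a b p.
Proof.
rewrite nabla_coord (_ : (fun q => _) = fun=> (k == b)%:R); last first.
  by apply/funext => q; rewrite mxE eqxx.
rewrite pd_cst add0r; under eq_bigr do rewrite mxE eqxx /= mulrC.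
exact: sum_deltal.
Qed.

Lemma lie_bracket_coord (a b : 'I_n) :
  lie_bracket (coord_field a) (coord_field b) = fun=> 0 :> 'rV[R]_n.
Proof.
apply/funext => p; apply/rowP => k; rewrite [LHS]mxE [RHS]mxE big1 // => i _.
have cst c : (fun q : 'rV[R]_n => coord_field c q 0 k) = fun=> (k == c)%:R.
  by apply/funext => q; rewrite mxE eqxx.
by rewrite !cst !pd_cst !mulr0 subr0.
Qed.

(** Coordinate fields commute, so only second covariant derivatives remain; the sign convention of
    [curvature] puts the derivative along [b] first. *)
Lemma curvature_coord g (a b c k : 'I_n) p :
  curvature g (coord_field a) (coord_field b) (coord_field c) p 0 k
  = pd b (christoffel g k a c) p - pd a (christoffel g k b c) p
    + \sum_(j < n) (christoffel g k b j p * christoffel g j a c p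
                    - christoffel g k a j p * christoffel g j b c p).
Proof.
have N d e j : (fun q => nabla g (coord_field d) (coord_field e) q 0 j)
               = christoffel g j d e.
  by apply/funext => q; rewrite nabla_coord2.
have Z (W : vfield R n) : nabla g (fun=> 0) W p = 0.
  by apply/rowP => j; rewrite mxE [RHS]mxE big1 // => i _; rewrite mxE mul0r.
have E d e : nabla g (coord_field d) (nabla g (coord_field e) (coord_field c)) p 0 k
   = pd d (christoffel g k e c) p
     + \sum_(j < n) christoffel g k d j p * christoffel g j e c p.
  by rewrite nabla_coord N; under eq_bigr do rewrite nabla_coord2.
have coordB (u v : 'rV[R]_n) : (u - v) 0 k = u 0 k - v 0 k by rewrite !mxE.
by rewrite /curvature lie_bracket_coord Z sub0r opprB coordB !E sumrB opprD addrACA.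
Qed.

Lemma riemann_christoffel g (a b c d : 'I_n) p :
  riemann g p a b c d
  = \sum_(k < n) (pd b (christoffel g k a c) p - pd a (christoffel g k b c) p
    + \sum_(j < n) (christoffel g k b j p * christoffel g j a c p
                    - christoffel g k a j p * christoffel g j b c p)) * g p k d.
Proof.
rewrite /riemann; have E k := curvature_coord g a b c k p.
move: (curvature _ _ _ _ _) E => C E.
rewrite /gdot mxE (bigD1 d) //= [X in _ + X]big1 ?addr0; last first.
  by move=> e ed; rewrite !mxE (negPf ed) mulr0.
rewrite !mxE !eqxx mulr1; apply: eq_bigr => k _. by rewrite E.
Qed.

(** Moving along x_i changes coordinate [o] at unit speed if i = o and not at all otherwise.
    Agreement near [p] is what formulas valid on an open domain provide. *)
Lemma pd_line (o i : 'I_n) (f : 'rV[R]_n -> R) (f0 : R -> R) (df : R) p :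
  (\forall q \near p, f q = f0 (q 0 o)) -> is_derive (p 0 o) 1 f0 df ->
  pd i f p = (i == o)%:R * df.
Proof.
move=> ff0 [_ <-].
transitivity ('D_(delta_mx 0 i) (fun q : 'rV[R]_n => f0 (q 0 o)) p).
  exact: near_eq_derive.
rewrite /derive.
have [->|io] := eqVneq i o.
  rewrite mul1r; rewrite (_ : (fun h => _)
      = (fun h : R => h^-1 *: (f0 (h *: 1 + p 0 o) - f0 (p 0 o)))) //.
  by apply/funext => h /=; rewrite !mxE !eqxx.
rewrite mul0r (_ : (fun h => _) = cst 0); first by apply: norm_cvg_lim; exact: cvg_cst.
apply/funext => h /=; rewrite !mxE eqxx eq_sym (negPf io) mulr0 add0r.
by rewrite subrr scaler0.
Qed.

End Riemann.

(** * Metrics that are diagonal and depend on one coordinate *)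

Section LineMetric.
Variables (R : realType) (n : nat) (o : 'I_n) (D : set R).
(** Working with h_j, half the logarithmic derivative of G_j, makes Christoffel symbols and
    curvature rational in G, h and h', without derivatives of G. *)
Variables G h h' : 'I_n -> R -> R.
Hypothesis openD : open D.
Hypothesis G_neq0 : forall j x, D x -> G j x != 0.
Hypothesis derG : forall j x, D x -> is_derive x 1 (G j) (2 * h j x * G j x).
Hypothesis derh : forall j x, D x -> is_derive x 1 (h j) (h' j x).
Implicit Types p : 'rV[R]_n.

Let g : metric R n := fun p => diag_mx (\row_j G j (p 0 o)).

Lemma near_line p : D (p 0 o) -> \forall q \near p, D ((q : 'rV[R]_n) 0 o).
Proof.
move=> Dp; apply: (@coord_continuous R 1 n 0 o p).
exact: open_nbhs_nbhs.
Qed.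

(** The nonzero symbols are Gamma^k_{ok} = Gamma^k_{ko} = h_k and, for i != o, Gamma^o_{ii} = - h_i
    G_i / G_o; at i = j = k = o the three terms add up to h_o. *)
Definition line_christoffel (k i j : 'I_n) (x : R) : R :=
  (i == o)%:R * (j == k)%:R * h k x + (j == o)%:R * (i == k)%:R * h k x
  - (k == o)%:R * (i == j)%:R * (h i x * G i x / G o x).

Lemma christoffel_line k i j p : D (p 0 o) ->
  christoffel g k i j p = line_christoffel k i j (p 0 o).
Proof.
move=> Dp; have pdg m a b : pd m (fun q => g q a b) p
    = (m == o)%:R * ((a == b)%:R * (2 * h a (p 0 o) * G a (p 0 o))).
  apply: (@pd_line _ _ _ _ _ (fun x => (a == b)%:R * G a x)).
    by near=> q; rewrite !mxE mulr_natl.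
  by have dGa := derG a Dp; apply: is_derive_eq.
have e l : invmx (g p) k l = (k == l)%:R * (G k (p 0 o))^-1.
  rewrite invmx_diag; last by move=> m; rewrite mxE G_neq0.
  by rewrite !mxE mulr_natl.
have Gk := G_neq0 k Dp; have Go := G_neq0 o Dp.
rewrite /christoffel; under eq_bigr do rewrite e -mulrA.
rewrite sum_deltar !pdg /line_christoffel.
case_eqs; by field; rewrite ?Gk ?Go.
Unshelve. all: by end_near.
Qed.

Definition line_dchristoffel (k i j : 'I_n) (x : R) : R :=
  (i == o)%:R * (j == k)%:R * h' k x + (j == o)%:R * (i == k)%:R * h' k x
  - (k == o)%:R * (i == j)%:R
    * ((h' i x + 2 * h i x * (h i x - h o x)) * G i x / G o x).

Lemma pd_christoffel_line a k i j p : D (p 0 o) ->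
  pd a (christoffel g k i j) p = (a == o)%:R * line_dchristoffel k i j (p 0 o).
Proof.
move=> Dp; apply: (@pd_line _ _ _ _ _ (line_christoffel k i j)).
  by near=> q; apply: christoffel_line; near: q; exact: near_line.
have dh m := derh m Dp; have dG m := derG m Dp; have Go := G_neq0 o Dp.
have := is_deriveV Go (dG o) => dGV.
rewrite /line_christoffel /line_dchristoffel; apply: is_derive_eq.
rewrite /GRing.scale /=; by field.
Unshelve. all: by end_near.
Qed.

(* The curvature-like tensor with sectional curvatures [tau a b] for the metric
   with diagonal [e]; the values [tau a a] are irrelevant. *)
Definition sectional (e : 'I_n -> R) (tau : 'I_n -> 'I_n -> R) : tensor4 R n :=
  fun a b c d => tau a b * e a * e b *
    ((a == d)%:R * (b == c)%:R - (a == c)%:R * (b == d)%:R).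

(** For a = b the bracket of deltas, being skew in a and b, vanishes. *)
Lemma eq_sectional e tau tau' : (forall a b, a != b -> tau a b = tau' a b) ->
  sectional e tau = sectional e tau'.
Proof.
move=> eqt; apply/funext=> a; apply/funext=> b; apply/funext=> c; apply/funext=> d.
rewrite /sectional; have [->|/eqt->//] := eqVneq a b.
by rewrite [X in _ - X]mulrC subrr !mulr0.
Qed.

(** In the sign convention of [curvature] this is minus the usual sectional curvature: for dx^2 +
    f^2 dy^2 it is the second derivative of f divided by f. *)
Definition line_sectional (a b : 'I_n) (x : R) : R :=
  (if a == o then h' b x + h b x ^+ 2 - h o x * h b x
   else if b == o then h' a x + h a x ^+ 2 - h o x * h a x
   else h a x * h b x) / G o x.

(** Each of the three terms of the first symbol contains a delta that fixes j, which removes the sum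
    before any case analysis. *)
Lemma sum_line_christoffel k a b c x :
  \sum_(j < n) line_christoffel k a j x * line_christoffel j b c x
  = (a == o)%:R * (h k x * line_christoffel k b c x)
    + (a == k)%:R * (h k x * line_christoffel o b c x)
    - (k == o)%:R * (h a x * G a x / G o x * line_christoffel a b c x).
Proof.
rewrite -(sum_deltal k (fun j => h k x * line_christoffel j b c x)).
rewrite -(sum_deltal o (fun j => h k x * line_christoffel j b c x)).
rewrite -(sum_deltar a (fun j => h a x * G a x / G o x * line_christoffel j b c x)).
rewrite !mulr_sumr -sumrN -!big_split /=; apply: eq_bigr => j _.
by rewrite {1}/line_christoffel; ring.
Qed.

Lemma riemann_line p : D (p 0 o) ->
  riemann g p = sectional (G^~ (p 0 o)) (fun a b => line_sectional a b (p 0 o)).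
Proof.
move=> Dp; apply/funext=> a; apply/funext=> b; apply/funext=> c; apply/funext=> d.
rewrite riemann_christoffel.
have E k : g p k d = (k == d)%:R * G d (p 0 o).
  by rewrite !mxE mulr_natl; case: eqVneq => [->|].
under eq_bigr do rewrite E mulrCA.
rewrite sum_deltal !pd_christoffel_line //.
under eq_bigr do rewrite !christoffel_line //.
rewrite sumrB !sum_line_christoffel.
have Go := G_neq0 o Dp; have Ga := G_neq0 a Dp; have Gb := G_neq0 b Dp.
have Gd := G_neq0 d Dp; have Gc := G_neq0 c Dp.
rewrite /line_dchristoffel /line_christoffel /sectional /line_sectional.
(* Each pattern of equalities among a, b, c, d and o leaves a rational identity in G, h and h'. *)
case_eqs; by field; rewrite ?Go ?Ga ?Gb.
Qed.

End LineMetric.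

(** * Tensors given by sectional curvatures *)

Section Sectional.
Variables (R : realType) (n : nat) (e : 'I_n -> R).
Hypothesis e_neq0 : forall i, e i != 0.
Variables (g : metric R n) (p : 'rV[R]_n).
Hypothesis g_diag : g p = diag_mx (\row_j e j).

Lemma invmetric : invmx (g p) = diag_mx (\row_j (e j)^-1).
Proof.
rewrite g_diag invmx_diag => [|i]; last by rewrite mxE.
by congr diag_mx; apply/rowP => i; rewrite !mxE.
Qed.

Lemma invmetric_entry a b : invmx (g p) a b = (a == b)%:R * (e a)^-1.
Proof. by rewrite invmetric !mxE mulr_natl; case: eqVneq => [->|]. Qed.

(** The inverse metric forces d = a, and the term a = b vanishes by skewness. *)
Lemma sum_sectional tau b c :
  \sum_(a < n) \sum_(d < n) invmx (g p) a d * sectional e tau a b c d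
  = (b == c)%:R * ((\sum_(a < n | a != b) tau a b) * e b).
Proof.
under eq_bigr => a _ do under eq_bigr do rewrite invmetric_entry -mulrA.
under eq_bigr => a _ do rewrite sum_deltar.
rewrite (bigD1 b) //= mulr_suml mulr_sumr /sectional !eqxx [X in X + _](_ : _ = 0).
  rewrite add0r; apply: eq_bigr => a /negPf ab; have ea := e_neq0 a.
  by case_eqs; field.
by case_eqs; ring.
Qed.

Lemma ricci_sectional tau : riemann g p = sectional e tau ->
  ricci g p = diag_mx (\row_b ((\sum_(a < n | a != b) tau a b) * e b)).
Proof.
move=> Rtau; apply/matrixP => b c; rewrite !mxE Rtau sum_sectional mulr_natl.
by case: eqVneq => [->|].
Qed.

Lemma scalar_curvature_diag s : ricci g p = diag_mx (\row_b (s b * e b)) ->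
  scalar_curvature g p = \sum_(b < n) s b.
Proof.
rewrite /scalar_curvature => ->; apply: eq_bigr => b _.
under eq_bigr do rewrite invmetric_entry -mulrA.
by rewrite sum_deltar !mxE eqxx mulr1n mulrC mulfK.
Qed.

(** With (0,2)-tensors written through the eigenvalues s of their endomorphisms, wedge products stay
    of sectional type, and identities between them become scalar equations for pairs of indices. *)
Lemma wedge_sectional s s' :
  wedge (diag_mx (\row_b (s b * e b))) (diag_mx (\row_b (s' b * e b)))
  = sectional e (fun a b => s a * s' b + s b * s' a).
Proof.
apply/funext=> a; apply/funext=> b; apply/funext=> c; apply/funext=> d.
by rewrite /wedge /sectional !mxE; case_eqs; ring.
Qed.

Lemma sym_endo_diag s :
  sym_endo g p (diag_mx (\row_b (s b * e b))) = diag_mx (\row_b s b).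
Proof.
apply/matrixP => a b; rewrite /sym_endo invmetric mul_diag_mx !mxE.
have [->|ab] := eqVneq a b; last by rewrite !mulr0n mulr0.
by rewrite !mulr1n mulrC mulfK.
Qed.

(* The common shape of [endo4 g p A u v] for [A = sectional e kap] and of
   [wedge_endo B u v] for [B] diagonal; row [a] is the image of d_a. *)
Definition rotation (u v : 'I_n) (x y : R) : 'M[R]_n :=
  \matrix_(a < n, c < n) (x * (v == a)%:R * (u == c)%:R
                          - y * (u == a)%:R * (v == c)%:R).

(* The components of [derivation4] along a rotation, [w b] being the weight
   [x t u b - y t v b] for [t] the sectional coefficients. *)
Definition rot_form (u v : 'I_n) (w : 'I_n -> R) (a b c d : 'I_n) : R :=
  - (((b == c)%:R * ((a == v)%:R * (d == u)%:R + (a == u)%:R * (d == v)%:R)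
      - (b == d)%:R * ((a == v)%:R * (c == u)%:R + (a == u)%:R * (c == v)%:R))
     * w b
   + ((a == d)%:R * ((b == v)%:R * (c == u)%:R + (b == u)%:R * (c == v)%:R)
      - (a == c)%:R * ((b == v)%:R * (d == u)%:R + (b == u)%:R * (d == v)%:R))
     * w a).

Lemma rot_formZ k u v w a b c d :
  k * rot_form u v w a b c d = rot_form u v (fun i => k * w i) a b c d.
Proof. by rewrite /rot_form; ring. Qed.

Lemma rot_formD u v w w' a b c d :
  rot_form u v w a b c d + rot_form u v w' a b c d
  = rot_form u v (fun i => w i + w' i) a b c d.
Proof. by rewrite /rot_form; ring. Qed.

Lemma rot_formB u v w w' a b c d :
  rot_form u v w a b c d - rot_form u v w' a b c d
  = rot_form u v (fun i => w i - w' i) a b c d.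
Proof. by rewrite /rot_form; ring. Qed.

Lemma eq_rot_form u v w w' a b c d : w =1 w' ->
  rot_form u v w a b c d = rot_form u v w' a b c d.
Proof. by move=> ww'; rewrite /rot_form !ww'. Qed.

Lemma derivation4_rotation u v x y tau a b c d :
  (forall i j, tau i j = tau j i) ->
  derivation4 (rotation u v x y) (sectional e tau) a b c d
  = rot_form u v (fun i => (x * (tau u i * e u) - y * (tau v i * e v)) * e i)
      a b c d.
Proof.
move=> tauC; have sumr i (F : 'I_n -> R) : \sum_j rotation u v x y i j * F j
    = x * (v == i)%:R * F u - y * (u == i)%:R * F v.
  rewrite -(sum_deltar u (fun j => x * (v == i)%:R * F j)).
  rewrite -(sum_deltar v (fun j => y * (u == i)%:R * F j)) -sumrB.
  by apply: eq_bigr => j _; rewrite mxE; ring.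
rewrite /derivation4 !big_split /= !sumr /sectional /rot_form.
(* Writing tau as a symmetrization lets [ring] see its symmetry. *)
have [sig tauE] : exists sig, forall i j, tau i j = sig i j + sig j i.
  by exists (fun i j => tau i j / 2) => i j; rewrite (tauC j i); field.
by rewrite !tauE; case_eqs; ring.
Qed.

Lemma dot4_sectional kap tau a b c d u v : (forall i j, tau i j = tau j i) ->
  dot4 g p (sectional e kap) (sectional e tau) a b c d u v
  = rot_form u v (fun i => e u * e v * e i * (kap u v * (tau u i - tau v i)))
      a b c d.
Proof.
move=> tauC; rewrite /dot4.
have -> : endo4 g p (sectional e kap) u v
    = rotation u v (kap u v * e v) (kap u v * e u).
  apply/matrixP => i j; rewrite /endo4 invmetric mul_mx_diag !mxE /sectional.
  by have ej := e_neq0 j; case_eqs; field.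
by rewrite derivation4_rotation //; apply: eq_rot_form => i; ring.
Qed.

Lemma tachibana_sectional s tau a b c d u v : (forall i j, tau i j = tau j i) ->
  tachibana (diag_mx (\row_i (s i * e i))) (sectional e tau) a b c d u v
  = rot_form u v (fun i => e u * e v * e i * (s v * tau u i - s u * tau v i))
      a b c d.
Proof.
move=> tauC; rewrite /tachibana.
have -> : wedge_endo (diag_mx (\row_i (s i * e i))) u v
    = rotation u v (s v * e v) (s u * e u).
  apply/matrixP => i j; rewrite !mxE eqxx /=; case_eqs; ring.
by rewrite derivation4_rotation //; apply: eq_rot_form => i; ring.
Qed.

Lemma sum_diag_mx s k (F : 'I_n -> R) :
  \sum_i diag_mx (\row_j s j) i k * F i = s k * F k.
Proof.
rewrite -(sum_deltal k (fun i => s i * F i)).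
by apply: eq_bigr => i _; rewrite !mxE mulrA mulr_natl.
Qed.

(** Each product of two deltas occurs twice with opposite signs, and forces the two coefficients to
    agree. *)
Lemma compatible_sectional s tau a b c x :
  \sum_(i < n) (diag_mx (\row_j s j) i a * sectional e tau i x b c
                + diag_mx (\row_j s j) i b * sectional e tau i x c a
                + diag_mx (\row_j s j) i c * sectional e tau i x a b) = 0.
Proof.
by rewrite !big_split /= !sum_diag_mx /sectional; case_eqs; ring.
Qed.

End Sectional.

(** * Covariant derivatives *)

Section Nabla.
Variables (R : realType) (n : nat) (o : 'I_n) (D : set R).
Variables G h : 'I_n -> R -> R.
Hypothesis openD : open D.
Hypothesis G_neq0 : forall j x, D x -> G j x != 0.
Hypothesis derG : forall j x, D x -> is_derive x 1 (G j) (2 * h j x * G j x).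
Implicit Types p : 'rV[R]_n.

Let g : metric R n := fun p => diag_mx (\row_j G j (p 0 o)).
Variables (T : 'rV[R]_n -> tensor4 R n) (tau dtau : 'I_n -> 'I_n -> R -> R).
Hypothesis tauC : forall i j x, tau i j x = tau j i x.
Hypothesis dertau : forall i j x, D x -> is_derive x 1 (tau i j) (dtau i j x).
Hypothesis T_tau : forall p, D (p 0 o) ->
  T p = sectional (G^~ (p 0 o)) (fun i j => tau i j (p 0 o)).

(** Reads the connection terms as the derivation action of the matrix of Christoffel symbols, so
    that [derivation4_rotation] applies. *)
Lemma nabla4_derivation m p a b c d : nabla4 g T m p a b c d
  = pd m (fun q => T q a b c d) p
    + derivation4 (\matrix_(i, k) christoffel g k m i p) (T p) a b c d.
Proof.
rewrite /nabla4 /derivation4; congr (_ - _).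
by apply: eq_bigr => k _; rewrite !mxE.
Qed.

(** Along x_o the connection matrix is diagonal and cancels the derivatives of the metric factors,
    leaving the derivative of tau. Along any other x_m it is a rotation in the plane of d_m and
    d_o. *)
Lemma nabla4_line m p a b c d : D (p 0 o) -> let x := p 0 o in
  nabla4 g T m p a b c d
  = (m == o)%:R * sectional (G^~ x) (fun i j => dtau i j x) a b c d
    + rot_form m o
        (fun i => h m x * G m x * G i x * (tau m i x - tau o i x)) a b c d.
Proof.
move=> Dp x; rewrite nabla4_derivation T_tau //.
pose s := (a == d)%:R * (b == c)%:R - (a == c)%:R * (b == d)%:R : R.
have -> : pd m (fun q => T q a b c d) p = (m == o)%:R *
    ((dtau a b x + 2 * (h a x + h b x) * tau a b x) * G a x * G b x * s).
  apply: (@pd_line _ _ _ _ _ (fun x => tau a b x * G a x * G b x * s)).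
    by near=> q; rewrite T_tau //; near: q; exact: near_line.
  have dt := dertau a b Dp; have da := derG a Dp; have db := derG b Dp.
  by apply: is_derive_eq; rewrite /GRing.scale /= -/x; ring.
have Go := G_neq0 o Dp.
have -> : \matrix_(i, k) christoffel g k m i p
   = (if m == o then diag_mx (\row_i h i x)
      else rotation m o (h m x) (h m x * G m x / G o x)) :> 'M[R]_n.
  apply/matrixP => i k; rewrite mxE (christoffel_line G_neq0 derG) // /line_christoffel.
  case: (eqVneq m o) => [->|/negPf mo]; rewrite !mxE -/x; last by case_eqs; ring.
  by case_eqs; field.
have [->|mo] := eqVneq m o.
  have sumr i (F : 'I_n -> R) :
      \sum_k diag_mx (\row_i h i x) i k * F k = h i x * F i.
    rewrite -(sum_deltar i (fun k => h i x * F k)).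
    by apply: eq_bigr => k _; rewrite !mxE mulrA mulr_natl.
  rewrite /derivation4 !big_split /= !sumr /rot_form /sectional -/x /s.
  by case_eqs; ring.
rewrite derivation4_rotation => [|i j]; last exact: tauC.
rewrite !mul0r !add0r; apply: eq_rot_form => i; rewrite -/x.
by field.
Unshelve. all: by end_near.
Qed.

(** The cyclic sum is a genuine condition only when the three cyclic indices are o, i, j, all
    distinct; it is then the hypothesis. The case w = 0 has the form of the second Bianchi
    identity. *)
Lemma recurrent_line p (w : R) a b c y z : D (p 0 o) -> let x := p 0 o in
  (forall i j, i != o -> j != o -> i != j ->
     dtau i j x + h i x * (tau i j x - tau o j x)
       + h j x * (tau i j x - tau i o x) = w * tau i j x) ->
  nabla4 g T a p b c y z + nabla4 g T b p c a y z + nabla4 g T c p a b y z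
  = (a == o)%:R * w * T p b c y z + (b == o)%:R * w * T p c a y z
    + (c == o)%:R * w * T p a b y z.
Proof.
move=> Dp x H; rewrite !nabla4_line // T_tau // -/x.
have [sg tauE] : exists sg, forall i j, tau i j x = sg i j + sg j i.
  by exists (fun i j => tau i j x / 2) => i j; rewrite (tauC j i); field.
have dtauC i j : dtau i j x = dtau j i x.
  have tauij : tau i j = tau j i by apply/funext => x1; exact: tauC.
  by have [_ <-] := dertau i j Dp; rewrite tauij; have [_ ->] := dertau j i Dp.
(* One rewriting rule carries both the symmetry of [dtau] and the hypothesis; [dd] is half of
   [dtau], used where the hypothesis is silent. *)
have [dd dtauE] : exists dd : 'I_n -> 'I_n -> R, forall i j, dtau i j x =
    if [|| i == o, j == o | i == j] then dd i j + dd j i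
    else w * tau i j x - h i x * (tau i j x - tau o j x)
         - h j x * (tau i j x - tau i o x).
  exists (fun i j => dtau i j x / 2) => i j.
  case: ifPn => [_|]; first by rewrite (dtauC j i); field.
  by rewrite !negb_or => /and3P[io jo ij]; rewrite -H //; ring.
by rewrite /rot_form /sectional !dtauE !tauE; case_eqs; ring.
Qed.

End Nabla.

(** * The Melvin metric *)

(** Polynomials in one coordinate are stable under partial derivatives. This provides the smooth
    coefficients of the Ein(2) relation. *)
Lemma smooth_on_poly (R : realType) n (D : set 'rV[R]_n) (o : 'I_n) (q : {poly R}) :
  smooth_on D (fun p => q.[p 0 o]).
Proof.
move=> s p _; have [q' ->] : exists q' : {poly R},
    iter_pd s (fun p => q.[p 0 o]) = fun p => q'.[p 0 o].
  elim: s => [|i s [q' /= ->]]; first by exists q.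
  exists ((i == o)%:R *: q'^`()); apply/funext => x; rewrite hornerZ.
  apply: (@pd_line _ _ _ _ _ (horner q')); by near=> z.
change (differentiable (horner q' \o (fun x : 'rV[R]_n => x 0 o)) p).
apply: differentiable_comp.
  exact: differentiable_coord.
exact/derivable1_diffP/derivable_horner.
Unshelve. all: by end_near.
Qed.

Section Melvin.
Variables (R : realType) (B : R).
Implicit Types (x : R) (i j : 'I_4).

Definition melvin_diag (j : 'I_4) (x : R) : R := let U := melvin_U B x in
  [:: - U ^+ 2; U ^+ 2; U ^+ 2; x ^+ 2 / U ^+ 2]`_j.

(* [melvin_dlog j] is half the logarithmic derivative of [melvin_diag j]. *)
Definition melvin_dlog (j : 'I_4) (x : R) : R :=
  let a := 2 * B ^+ 2 * x / (4 + B ^+ 2 * x ^+ 2) in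
  if j == 3 then x^-1 - a else a.

Definition melvin_ddlog (j : 'I_4) (x : R) : R :=
  let a' := 2 * B ^+ 2 * (4 - B ^+ 2 * x ^+ 2) / (4 + B ^+ 2 * x ^+ 2) ^+ 2 in
  if j == 3 then - x^-1 ^+ 2 - a' else a'.

Lemma melvinE : melvin B = fun p => diag_mx (\row_j melvin_diag j (p 0 1)).
Proof. by []. Qed.

Lemma melvin_plus_gt0 x : 0 < 4 + B ^+ 2 * x ^+ 2.
Proof. by rewrite -exprMn ltr_pwDl ?ltr0n // sqr_ge0. Qed.

Lemma melvin_plus_neq0 x : 4 + B ^+ 2 * x ^+ 2 != 0.
Proof. exact/lt0r_neq0/melvin_plus_gt0. Qed.

Lemma melvin_UE x : melvin_U B x = (4 + B ^+ 2 * x ^+ 2) / 4.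
Proof. by rewrite /melvin_U; field. Qed.

Lemma melvin_U_neq0 x : melvin_U B x != 0.
Proof. by rewrite melvin_UE mulf_neq0 ?melvin_plus_neq0 ?invr_eq0 ?pnatr_eq0. Qed.

Lemma melvin_diag_neq0 j x : 0 < x -> melvin_diag j x != 0.
Proof.
move=> /lt0r_neq0 x0; have U0 := melvin_U_neq0 x; rewrite /melvin_diag.
by case_ord j; rewrite /= ?oppr_eq0 ?mulf_neq0 ?invr_eq0 ?expf_neq0.
Qed.

Lemma is_derive_melvin_diag j (x : R) : 0 < x ->
  is_derive x 1 (melvin_diag j) (2 * melvin_dlog j x * melvin_diag j x).
Proof.
move=> /lt0r_neq0 x0; have U0 := melvin_U_neq0 x; have P0 := melvin_plus_neq0 x.
have dU : is_derive x 1 (melvin_U B) (B ^+ 2 * x / 2).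
  rewrite /melvin_U; apply: is_derive_eq; rewrite /GRing.scale /=; by field.
have U2 : (melvin_U B ^+ 2) x != 0 by rewrite fctE expf_neq0.
have dV := is_deriveV U2 (is_deriveX 2 dU).
rewrite /melvin_diag /melvin_dlog; case_ord j; rewrite /=; apply: is_derive_eq;
  rewrite /GRing.scale /= ?fctE melvin_UE; field; by rewrite ?exprMn ?x0 ?P0.
Qed.

Lemma is_derive_melvin_dlog j (x : R) : 0 < x ->
  is_derive x 1 (melvin_dlog j) (melvin_ddlog j x).
Proof.
move=> /lt0r_neq0 x0; have P0 := melvin_plus_neq0 x.
have dP : is_derive x 1 (fun y : R => 4 + B ^+ 2 * y ^+ 2) (2 * B ^+ 2 * x).
  by apply: is_derive_eq; rewrite /GRing.scale /=; ring.
have dPV := is_deriveV (f := fun y : R => 4 + B ^+ 2 * y ^+ 2) P0 dP.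
have dxV := is_deriveV (f := @id R) x0 (is_derive_id x 1).
rewrite /melvin_dlog /melvin_ddlog; case: ifP => _; apply: is_derive_eq;
  by rewrite /GRing.scale /=; field; rewrite ?exprMn ?P0 ?x0.
Qed.

(** The common factor of all curvatures: the Ricci eigenvalues are 8 and -8 times it, and L1 is 4 -
    B^2 x^2 times it. *)
Definition melvin_scale x : R := 32 * B ^+ 2 / (4 + B ^+ 2 * x ^+ 2) ^+ 4.

Lemma melvin_scale_neq0 x : B != 0 -> melvin_scale x != 0.
Proof.
move=> /negPf B0; rewrite /melvin_scale !mulf_eq0 invr_eq0 !expf_eq0 /= pnatr_eq0.
by rewrite B0 (negPf (melvin_plus_neq0 x)).
Qed.

(* The blocks {t, z} and {r, phi} are the indices of even and of odd value; the
   irrelevant diagonal entries are chosen so that [melvin_sec] only depends on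
   the parities. *)
Definition melvin_sec i j x : R := melvin_scale x *
  if odd i then if odd j then 2 * B ^+ 2 * x ^+ 2 - 16 else 4 - B ^+ 2 * x ^+ 2
  else if odd j then 4 - B ^+ 2 * x ^+ 2 else 2 * B ^+ 2 * x ^+ 2.

Definition melvin_ric i x : R := melvin_scale x * if odd i then - 8 else 8.

(** Every index has one partner in its block and two outside it; -2 + 1 + 1 = 0 expresses that the
    conformal tensor is trace-free. *)
Definition melvin_conf i j x : R :=
  melvin_scale x * (4 - B ^+ 2 * x ^+ 2) * if odd i (+) odd j then 1 else - 2.

Lemma melvin_secC i j x : melvin_sec i j x = melvin_sec j i x.
Proof. by rewrite /melvin_sec; case: odd; case: odd. Qed.

Lemma melvin_confC i j x : melvin_conf i j x = melvin_conf j i x.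
Proof. by rewrite /melvin_conf addbC. Qed.

Definition melvin_dconf i j x : R :=
  - (64 * B ^+ 4 * x * (20 - 3 * B ^+ 2 * x ^+ 2) / (4 + B ^+ 2 * x ^+ 2) ^+ 5)
  * if odd i (+) odd j then 1 else - 2.

Lemma is_derive_melvin_conf i j (x : R) :
  is_derive x 1 (melvin_conf i j) (melvin_dconf i j x).
Proof.
have P0 := melvin_plus_neq0 x.
have dP : is_derive x 1 (fun y : R => 4 + B ^+ 2 * y ^+ 2) (2 * B ^+ 2 * x).
  by apply: is_derive_eq; rewrite /GRing.scale /=; ring.
have P4 : ((fun y : R => 4 + B ^+ 2 * y ^+ 2) ^+ 4) x != 0.
  by rewrite fctE expf_neq0.
have dPV := is_deriveV P4 (is_deriveX 4 dP).
rewrite /melvin_conf /melvin_dconf /melvin_scale; apply: is_derive_eq.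
by rewrite /GRing.scale /= ?fctE; field; rewrite ?exprMn ?P0.
Qed.

(** * Curvature tensors of the Melvin metric at a point *)

Variable p : 'rV[R]_4.
Hypothesis Mp : melvin_dom R p.
Let r := p 0 1.
Let e : 'I_4 -> R := melvin_diag^~ r.

Lemma melvin_sectionalE i j : i != j ->
  line_sectional 1 melvin_diag melvin_dlog melvin_ddlog i j r = melvin_sec i j r.
Proof.
have x0 : r != 0 by exact: lt0r_neq0.
have P0 := melvin_plus_neq0 r.
rewrite /line_sectional /melvin_sec /melvin_ddlog /melvin_dlog /melvin_scale.
rewrite {1}/melvin_diag /= melvin_UE.
case_ord i; case_ord j; rewrite //= => _; by field; rewrite ?exprMn ?P0 ?x0.
Qed.

Lemma riemann_melvin :
  riemann (melvin B) p = sectional e (fun i j => melvin_sec i j r).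
Proof.
rewrite melvinE (riemann_line (@open_gt _ 0) melvin_diag_neq0 is_derive_melvin_diag
  is_derive_melvin_dlog Mp).
by apply: eq_sectional => i j /melvin_sectionalE.
Qed.

Lemma ricci_melvin :
  ricci (melvin B) p = diag_mx (\row_i (melvin_ric i r * e i)).
Proof.
have e0 i : e i != 0 by exact: melvin_diag_neq0.
rewrite (ricci_sectional e0 _ riemann_melvin) //; congr diag_mx; apply/rowP => i.
rewrite !mxE; congr (_ * _); rewrite /melvin_ric /melvin_sec big_mkcond /=.
by rewrite !big_ord_recl big_ord0; case_ord i => /=; ring.
Qed.

Lemma scalar_curvature_melvin : scalar_curvature (melvin B) p = 0.
Proof.
have e0 i : e i != 0 by exact: melvin_diag_neq0.
rewrite (scalar_curvature_diag e0 _ ricci_melvin) //.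
by rewrite !big_ord_recl big_ord0 /melvin_ric /=; ring.
Qed.

(** The metric as a tensor with all eigenvalues 1, the shape expected by [wedge_sectional] and
    [tachibana_sectional]. *)
Lemma melvin_scaled : melvin B p = diag_mx (\row_i (1 * e i)).
Proof. by rewrite melvinE; congr diag_mx; apply/rowP => i; rewrite !mxE mul1r. Qed.

Lemma conharmonic_melvin :
  conharmonic (melvin B) p = sectional e (fun i j => melvin_conf i j r).
Proof.
apply/funext=> a; apply/funext=> b; apply/funext=> c; apply/funext=> d.
rewrite /conharmonic riemann_melvin ricci_melvin melvin_scaled wedge_sectional.
rewrite /sectional /melvin_sec /melvin_ric /melvin_conf.
by case: odd; case: odd => /=; field.
Qed.

Lemma conformal_conharmonic a b c d :
  conformal (melvin B) p a b c d = conharmonic (melvin B) p a b c d.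
Proof. by rewrite /conformal scalar_curvature_melvin !mul0r addr0. Qed.

Lemma conformal_melvin :
  conformal (melvin B) p = sectional e (fun i j => melvin_conf i j r).
Proof.
rewrite -conharmonic_melvin.
apply/funext=> a; apply/funext=> b; apply/funext=> c; apply/funext=> d.
exact: conformal_conharmonic.
Qed.

Let e0 i : e i != 0.
Proof. exact: melvin_diag_neq0. Qed.

Let ge : melvin B p = diag_mx (\row_i e i).
Proof. by []. Qed.

(** * Conditions of pseudosymmetry type and the Roter decomposition *)

Let L1 := 32 * B ^+ 2 * (4 - B ^+ 2 * r ^+ 2) / (4 + B ^+ 2 * r ^+ 2) ^+ 4.
Let omega := - 16 - 24 * B ^+ 2 * r ^+ 2 + 3 * B ^+ 4 * r ^+ 4.

Ltac parities u v i :=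
  rewrite /L1 /omega /melvin_sec /melvin_conf /melvin_ric /melvin_scale;
  case: (odd u); case: (odd v); case: (odd i) => /=.

(** The factor tau_ui - tau_vi vanishes when u and v share a block; otherwise tau_uv = L1. *)
Lemma melvin_pseudosymmetric a b c d u v :
  dot4 (melvin B) p (riemann (melvin B) p) (riemann (melvin B) p) a b c d u v
  = L1 * tachibana (melvin B p) (riemann (melvin B) p) a b c d u v.
Proof.
have sC i j := melvin_secC i j r; have P0 := melvin_plus_neq0 r.
rewrite riemann_melvin (dot4_sectional e0 ge) // melvin_scaled tachibana_sectional //.
rewrite rot_formZ; apply: eq_rot_form => i.
by parities u v i; field; rewrite ?exprMn ?P0.
Qed.

(** Across the blocks the conformal coefficient is L1 as well. *)
Lemma melvin_conformal_pseudosymmetric a b c d u v :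
  dot4 (melvin B) p (conformal (melvin B) p) (riemann (melvin B) p) a b c d u v
  = L1 * tachibana (melvin B p) (riemann (melvin B) p) a b c d u v.
Proof.
have sC i j := melvin_secC i j r; have P0 := melvin_plus_neq0 r.
rewrite conformal_melvin riemann_melvin (dot4_sectional e0 ge) // melvin_scaled.
rewrite tachibana_sectional // rot_formZ; apply: eq_rot_form => i.
by parities u v i; field; rewrite ?exprMn ?P0.
Qed.

(** Within a block all weights vanish. Across blocks L2 results from division by C_ui - C_vi, which
    is 3 L1 up to sign; hence the condition on 4 - B^2 r^2. *)
Lemma melvin_ricci_pseudosymmetric a b c d u v :
  4 - B ^+ 2 * r ^+ 2 != 0 ->
  dot4 (melvin B) p (riemann (melvin B) p) (riemann (melvin B) p) a b c d u v
  - tachibana (ricci (melvin B) p) (riemann (melvin B) p) a b c d u v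
  = - (32 * B ^+ 2 * (16 + 24 * B ^+ 2 * r ^+ 2 - 3 * B ^+ 4 * r ^+ 4)
       / (3 * (4 - B ^+ 2 * r ^+ 2) * (4 + B ^+ 2 * r ^+ 2) ^+ 4))
    * tachibana (melvin B p) (conformal (melvin B) p) a b c d u v.
Proof.
have sC i j := melvin_secC i j r; have cC i j := melvin_confC i j r.
have P0 := melvin_plus_neq0 r => M0.
rewrite conformal_melvin riemann_melvin ricci_melvin (dot4_sectional e0 ge) //.
rewrite melvin_scaled !tachibana_sectional // rot_formZ rot_formB.
apply: eq_rot_form => i.
by parities u v i; field; rewrite ?exprMn ?P0 ?M0.
Qed.

(** Across blocks C_uv = tau_uv = L1 and tau_ij - C_ij = (s_i + s_j) / 2, with s the Ricci
    eigenvalues, so both weights are L1 s_u e_u e_v e_i. *)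
Lemma melvin_commutator a b c d u v :
  tachibana (ricci (melvin B) p) (conformal (melvin B) p) a b c d u v
  = dot4 (melvin B) p (conformal (melvin B) p) (riemann (melvin B) p) a b c d u v
    - dot4 (melvin B) p (riemann (melvin B) p) (conformal (melvin B) p) a b c d u v.
Proof.
have sC i j := melvin_secC i j r; have cC i j := melvin_confC i j r.
have P0 := melvin_plus_neq0 r.
rewrite conformal_melvin riemann_melvin ricci_melvin !(dot4_sectional e0 ge) //.
rewrite tachibana_sectional // rot_formB; apply: eq_rot_form => i.
by parities u v i; field; rewrite ?exprMn ?P0.
Qed.

(** For u and v in different blocks, the two choices of the block of i give two linear equations for
    L3 and L4, whose determinant is a multiple of omega. *)
Lemma melvin_commutator_tachibana a b c d u v : omega != 0 ->
  dot4 (melvin B) p (conformal (melvin B) p) (riemann (melvin B) p) a b c d u v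
  - dot4 (melvin B) p (riemann (melvin B) p) (conformal (melvin B) p) a b c d u v
  = - (2 ^+ 11 * B ^+ 2 * (4 - B ^+ 2 * r ^+ 2)
       / (omega * (4 + B ^+ 2 * r ^+ 2) ^+ 4))
    * tachibana (melvin B p) (riemann (melvin B) p) a b c d u v
    + (1 + 64 / omega)
      * tachibana (ricci (melvin B) p) (riemann (melvin B) p) a b c d u v.
Proof.
have sC i j := melvin_secC i j r; have cC i j := melvin_confC i j r.
have P0 := melvin_plus_neq0 r => O0.
rewrite conformal_melvin riemann_melvin ricci_melvin !(dot4_sectional e0 ge) //.
rewrite melvin_scaled !tachibana_sectional // rot_formB !rot_formZ rot_formD.
apply: eq_rot_form => i; move: O0.
by parities u v i => O0; field; rewrite ?exprMn ?P0 ?O0.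
Qed.

(** The equation tau_ab = 2 N1 s_a s_b + N2 (s_a + s_b) + 2 N3, for the three kinds of pairs of
    blocks, determines the three coefficients. *)
Lemma melvin_roter a b c d : B != 0 ->
  riemann (melvin B) p a b c d
  = - (3 * (4 - B ^+ 2 * r ^+ 2) * (4 + B ^+ 2 * r ^+ 2) ^+ 4
       / (2 ^+ 13 * B ^+ 2))
    * wedge (ricci (melvin B) p) (ricci (melvin B) p) a b c d
    + 2^-1 * wedge (melvin B p) (ricci (melvin B) p) a b c d
    + - (8 * B ^+ 2 * (4 - B ^+ 2 * r ^+ 2) / (4 + B ^+ 2 * r ^+ 2) ^+ 4)
      * wedge (melvin B p) (melvin B p) a b c d.
Proof.
have P0 := melvin_plus_neq0 r => B0.
rewrite riemann_melvin ricci_melvin melvin_scaled !wedge_sectional /sectional.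
rewrite /melvin_sec /melvin_ric /melvin_scale.
by case: (odd a); case: (odd b) => /=; field; rewrite ?exprMn ?P0 ?B0.
Qed.

(** * The Ricci tensor: rank, square, Chaki form and compatibility *)

Lemma rank_ricci_melvin k :
  \rank (ricci (melvin B) p - k *: melvin B p)
  = (2 * (8 * melvin_scale r != k)%R + 2 * (- (8 * melvin_scale r) != k)%R)%N.
Proof.
have -> : ricci (melvin B) p - k *: melvin B p
    = diag_mx (\row_i ((melvin_ric i r - k) * e i)).
  rewrite ricci_melvin ge; apply/matrixP => i j; rewrite !mxE.
  by case: eqVneq => _; rewrite ?mulr1n ?mulr0n; ring.
rewrite rank_diag_mx (eq_bigr (fun i => (melvin_ric i r != k) : nat)); last first.
  by move=> i _; rewrite mxE mulf_eq0 (negPf (e0 i)) orbF subr_eq0.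
(* Each of the two Ricci eigenvalues occurs twice, so the rank is always even. *)
rewrite !big_ord_recl big_ord0 /melvin_ric /= mulrN [_ * 8]mulrC.
by case: (_ == k); case: (_ == k).
Qed.

Lemma ricci2_melvin : ricci2 (melvin B) p
  = (2 ^+ 16 * B ^+ 4 / (4 + B ^+ 2 * r ^+ 2) ^+ 8) *: melvin B p.
Proof.
have P0 := melvin_plus_neq0 r.
rewrite /ricci2 /ricci_op ricci_melvin (sym_endo_diag e0 ge) ge.
apply/matrixP => i j; rewrite !mul_diag_mx !mxE /melvin_ric /melvin_scale.
case: eqVneq => [->|_]; rewrite ?mulr1n ?mulr0n; last by rewrite !mulr0.
by case: odd; field; rewrite ?exprMn ?P0.
Qed.

Lemma ricci_melvin_chaki :
  let Pi := covector4
     (- (4 * Num.sqrt 2 * B / (4 + B ^+ 2 * r ^+ 2))) 0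
     (4 * Num.sqrt 2 * B
        / Num.sqrt (16 + 8 * B ^+ 2 * r ^+ 2 + B ^+ 4 * r ^+ 4)) 0 in
  let delta := covector4 0 0 (4 * Num.sqrt 2 * B / (4 + B ^+ 2 * r ^+ 2)) 0 in
  [/\ ricci (melvin B) p
      = - (256 * B ^+ 2 / (4 + B ^+ 2 * r ^+ 2) ^+ 4) *: melvin B p
        + -1 *: (Pi^T *m Pi) + 1 *: (Pi^T *m delta + delta^T *m Pi),
     conorm (melvin B) p Pi = 0
   & conorm (melvin B) p delta = 512 * B ^+ 2 / (4 + B ^+ 2 * r ^+ 2) ^+ 4].
Proof.
have P0 := melvin_plus_neq0 r.
have -> : Num.sqrt (16 + 8 * B ^+ 2 * r ^+ 2 + B ^+ 4 * r ^+ 4)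
    = 4 + B ^+ 2 * r ^+ 2.
  rewrite (_ : 16 + _ + _ = (4 + B ^+ 2 * r ^+ 2) ^+ 2); last by ring.
  by rewrite sqrtr_sqr ger0_norm // ltW // melvin_plus_gt0.
have : (4 * Num.sqrt 2 * B / (4 + B ^+ 2 * r ^+ 2)) ^+ 2
    = 32 * B ^+ 2 / (4 + B ^+ 2 * r ^+ 2) ^+ 2.
  by rewrite expr_div_n 2!exprMn sqr_sqrtr ?ler0n //; ring.
(* Now Pi = (-k, 0, k, 0) and delta = (0, 0, k, 0), so the quadratic part is k^2 (dz^2 - dt^2),
   supported on {t, z} like S - alpha g. Only k^2 enters, which eliminates the root of 2. *)
move: (4 * Num.sqrt 2 * B / _) => k kE Pi delta.
have conormE (th : 'rV[R]_4) : conorm (melvin B) p th = \sum_i th 0 i ^+ 2 / e i.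
  rewrite /conorm (invmetric e0 ge) mul_mx_diag mxE.
  by apply: eq_bigr => i _; rewrite !mxE; ring.
rewrite !conormE !big_ord_recl !big_ord0 /Pi /delta /e /melvin_diag !melvin_UE.
rewrite !mxE /=; split.
- rewrite ricci_melvin ge; apply/matrixP => i j.
  rewrite !mxE !big_ord1 !mxE /e /melvin_diag /melvin_ric /melvin_scale !melvin_UE.
  case_ord i; case_ord j; rewrite /= ?mulr1n ?mulr0n; try ring.
  + transitivity (256 * B ^+ 2 / (4 + B ^+ 2 * r ^+ 2) ^+ 4
        * ((4 + B ^+ 2 * r ^+ 2) / 4) ^+ 2 - k ^+ 2); last by ring.
    by rewrite kE; field; rewrite ?exprMn ?P0.
  + transitivity (- (256 * B ^+ 2 / (4 + B ^+ 2 * r ^+ 2) ^+ 4)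
        * ((4 + B ^+ 2 * r ^+ 2) / 4) ^+ 2 + k ^+ 2); last by ring.
    by rewrite kE; field; rewrite ?exprMn ?P0.
- by rewrite sqrrN expr0n invrN /=; ring.
- by rewrite kE; field; rewrite ?exprMn ?P0 //; exact: lt0r_neq0.
Qed.

Lemma riemann_compatible_melvin (a b c d : 'I_4) :
  \sum_(i < 4) (sym_endo (melvin B) p (ricci (melvin B) p) i a
                  * riemann (melvin B) p i d b c
                + sym_endo (melvin B) p (ricci (melvin B) p) i b
                  * riemann (melvin B) p i d c a
                + sym_endo (melvin B) p (ricci (melvin B) p) i c
                  * riemann (melvin B) p i d a b) = 0.
Proof.
by rewrite ricci_melvin riemann_melvin (sym_endo_diag e0 ge) compatible_sectional.
Qed.

(** As a = c, what survives is P_{0110} + P_{0101}, the failure of P to be skew in its last two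
    indices; it is proportional to the difference of the two Ricci eigenvalues. *)
Lemma projective_incompatible_melvin :
  \sum_(i < 4) (sym_endo (melvin B) p (ricci (melvin B) p) i 0
                  * projective (melvin B) p i 1 1 0
                + sym_endo (melvin B) p (ricci (melvin B) p) i 1
                  * projective (melvin B) p i 1 0 0
                + sym_endo (melvin B) p (ricci (melvin B) p) i 0
                  * projective (melvin B) p i 1 0 1)
  = 128 / 3 * melvin_scale r ^+ 2 * e 0 * e 1.
Proof.
rewrite ricci_melvin (sym_endo_diag e0 ge) !big_split /= !sum_diag_mx.
rewrite /projective riemann_melvin ricci_melvin ge /sectional !mxE /melvin_ric /=.
rewrite ?mulr1n ?mulr0n; by field.
Qed.

End Melvin.

(** * Recurrence of the curvature 2-forms *)

Section Recurrence.
Variables (R : realType) (B : R).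

(** Stated for a field [H] so as to serve both C and K; [w] solves the scalar equations of
    [recurrent_line] for all pairs among t, z, phi. *)
Lemma recurrent_melvin (H : 'rV[R]_4 -> tensor4 R 4) p a b c y z :
  (forall q, melvin_dom R q ->
    H q = sectional (melvin_diag B ^~ (q 0 1))
                    (fun i j => melvin_conf B i j (q 0 1))) ->
  melvin_dom R p -> 4 - B ^+ 2 * p 0 1 ^+ 2 != 0 ->
  let w := - (16 * B ^+ 2 * p 0 1
              / ((4 - B ^+ 2 * p 0 1 ^+ 2) * (4 + B ^+ 2 * p 0 1 ^+ 2))) in
  nabla4 (melvin B) H a p b c y z + nabla4 (melvin B) H b p c a y z
    + nabla4 (melvin B) H c p a b y z
  = (a == 1)%:R * w * H p b c y z + (b == 1)%:R * w * H p c a y z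
    + (c == 1)%:R * w * H p a b y z.
Proof.
move=> HE Mp minus0 w; rewrite melvinE.
apply: (recurrent_line (@open_gt _ 0) (@melvin_diag_neq0 _ B)
  (@is_derive_melvin_diag _ B) (@melvin_confC _ B)
  (fun i j x _ => is_derive_melvin_conf B i j x) HE) => //= i j i1 j1 ij.
have x0 : p 0 1 != 0 by exact: lt0r_neq0.
have P0 := melvin_plus_neq0 B (p 0 1).
rewrite /melvin_dconf /melvin_dlog /melvin_conf /melvin_scale /w.
move: i1 j1 ij; case_ord i; case_ord j; rewrite //= => _ _ _;
  by field; rewrite ?exprMn ?P0 ?x0 ?minus0.
Qed.

End Recurrence.

(** * Assembly of the nine properties from the pointwise results *)

Theorem theorem4p1 (R : realType) (B0 : R) :
  let g := melvin B0 in
  let M := melvin_dom R in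
  let r := @rcoord R in
  (* plus = 4 + B0^2 r^2, minus = 4 - B0^2 r^2; 2048, 8192 and 65536 are
     written 2 ^+ 11, 2 ^+ 13 and 2 ^+ 16, literals being unary *)
  let plus p := 4 + B0 ^+ 2 * r p ^+ 2 in
  let minus p := 4 - B0 ^+ 2 * r p ^+ 2 in
  let omega p := - 16 - 24 * B0 ^+ 2 * r p ^+ 2 + 3 * B0 ^+ 4 * r p ^+ 4 in
  let L1 p := 32 * B0 ^+ 2 * minus p / plus p ^+ 4 in
  let L2 p := - (32 * B0 ^+ 2
                 * (16 + 24 * B0 ^+ 2 * r p ^+ 2 - 3 * B0 ^+ 4 * r p ^+ 4)
                 / (3 * minus p * plus p ^+ 4)) in
  let L3 p := - (2 ^+ 11 * B0 ^+ 2 * minus p / (omega p * plus p ^+ 4)) in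
  let L4 p := 1 + 64 / omega p in
  let N1 p := - (3 * minus p * plus p ^+ 4 / (2 ^+ 13 * B0 ^+ 2)) in
  let N2 (p : 'rV[R]_4) := 2^-1 in
  let N3 p := - (8 * B0 ^+ 2 * minus p / plus p ^+ 4) in
  [/\
   (* (i) *)
   forall p, M p ->
     [/\ scalar_curvature g p = 0,
         forall a b c d, conformal g p a b c d = conharmonic g p a b c d
       & forall a b c d, riemann g p a b c d = concircular g p a b c d],
   (* (ii) *)
   forall p, M p -> forall a b c d u v,
     dot4 g p (riemann g p) (riemann g p) a b c d u v
       = L1 p * tachibana (g p) (riemann g p) a b c d u v /\
     dot4 g p (conformal g p) (riemann g p) a b c d u v
       = L1 p * tachibana (g p) (riemann g p) a b c d u v,
   (* (iii) *)
   [/\ forall p, M p -> minus p != 0 -> forall a b c d u v,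
         dot4 g p (riemann g p) (riemann g p) a b c d u v
         - tachibana (ricci g p) (riemann g p) a b c d u v
         = L2 p * tachibana (g p) (conformal g p) a b c d u v,
       forall p, M p -> forall a b c d u v,
         tachibana (ricci g p) (conformal g p) a b c d u v
         = dot4 g p (conformal g p) (riemann g p) a b c d u v
           - dot4 g p (riemann g p) (conformal g p) a b c d u v
     & forall p, M p -> omega p != 0 -> forall a b c d u v,
         dot4 g p (conformal g p) (riemann g p) a b c d u v
         - dot4 g p (riemann g p) (conformal g p) a b c d u v
         = L3 p * tachibana (g p) (riemann g p) a b c d u v
           + L4 p * tachibana (ricci g p) (riemann g p) a b c d u v]
   &
   [/\
   (* (iv) *)
   let D := [set p | M p /\ minus p != 0] in
   let Pi p := covector4 0 (- (16 * B0 ^+ 2 * r p / (minus p * plus p))) 0 0 in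
     recurrent_curvature_2forms g D (conformal g) Pi /\
     recurrent_curvature_2forms g D (conharmonic g) Pi,
   (* (v) *)
   B0 != 0 -> forall p, M p -> forall a b c d,
     riemann g p a b c d
     = N1 p * wedge (ricci g p) (ricci g p) a b c d
       + N2 p * wedge (g p) (ricci g p) a b c d
       + N3 p * wedge (g p) (g p) a b c d
   &
   [/\
   (* (vi) *)
   B0 != 0 ->
     two_quasi_einstein g M (fun p => 256 * B0 ^+ 2 / plus p ^+ 4),
   (* (vii) *)
   let Pi p := covector4
     (- (4 * Num.sqrt 2 * B0 / plus p)) 0
     (4 * Num.sqrt 2 * B0
        / Num.sqrt (16 + 8 * B0 ^+ 2 * r p ^+ 2 + B0 ^+ 4 * r p ^+ 4)) 0 in
   let delta p := covector4 0 0 (4 * Num.sqrt 2 * B0 / plus p) 0 in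
     chaki_generalized_quasi_einstein g M
       (fun p => - (256 * B0 ^+ 2 / plus p ^+ 4)) (fun=> - 1) (fun=> 1) Pi delta /\
     forall p, M p ->
       conorm g p (Pi p) = 0 /\
       conorm g p (delta p) = 512 * B0 ^+ 2 / plus p ^+ 4,
   (* (viii) *)
   let lambda p := - (2 ^+ 16 * B0 ^+ 4 / plus p ^+ 8) in
     (forall p, M p -> ricci2 g p + lambda p *: g p = 0) /\
     Ein2 g M (melvin_Cinf R)
   (* (ix) *)
   & compatible g M (ricci g) (riemann g) /\
     (B0 != 0 -> ~ compatible g M (ricci g) (projective g))]]].
Proof.
move=> g M r plus minus omega L1 L2 L3 L4 N1 N2 N3.
have conf p : M p -> forall a b c d, conformal g p a b c d = conharmonic g p a b c d.
  by move=> Mp a b c d; exact: conformal_conharmonic.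
split.
- move=> p Mp; split; [exact: scalar_curvature_melvin | exact: conf |].
  by move=> a b c d; rewrite /concircular scalar_curvature_melvin // !mul0r subr0.
- move=> p Mp a b c d u v; split; first exact: melvin_pseudosymmetric.
  exact: melvin_conformal_pseudosymmetric.
- split=> p Mp.
  + by move=> minus0 a b c d u v; exact: melvin_ricci_pseudosymmetric.
  + by move=> a b c d u v; exact: melvin_commutator.
  + by move=> omega0 a b c d u v; exact: melvin_commutator_tachibana.
split.
- have Pi1 w (a : 'I_4) : covector4 0 w 0 0 0 a = (a == 1)%:R * w :> R.
    by rewrite mxE; case_ord a; rewrite /= ?mul1r ?mul0r.
  split=> p [Mp minus0] a b c y z; rewrite !Pi1.
    by apply: recurrent_melvin => // q Mq; exact: conformal_melvin.
  by apply: recurrent_melvin => // q Mq; exact: conharmonic_melvin.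
- by move=> B_neq0 p Mp a b c d; exact: melvin_roter.
split.
- move=> B_neq0 p Mp; rewrite rank_ricci_melvin //.
  have P0 : 4 + B0 ^+ 2 * p 0 1 ^+ 2 != 0 := melvin_plus_neq0 B0 _.
  have scaleE : 256 * B0 ^+ 2 / plus p ^+ 4 = 8 * melvin_scale B0 (p 0 1).
    by rewrite /melvin_scale /plus /r /rcoord; field; rewrite ?exprMn ?P0.
  have scale0 := melvin_scale_neq0 (p 0 1) B_neq0.
  (* Here alpha is the eigenvalue on {t, z}; the other one differs from it since B0 is nonzero, and
     contributes rank 2. *)
  rewrite scaleE eqxx -subr_eq0 (_ : _ - _ = - 16 * melvin_scale B0 (p 0 1)).
    by rewrite mulf_eq0 oppr_eq0 pnatr_eq0 (negPf scale0).
  by ring.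
- split=> [|p Mp]; last by have [] := ricci_melvin_chaki B0 Mp.
  split=> [[alpha qe]|p Mp]; last by have [] := ricci_melvin_chaki B0 Mp.
  (* Being quasi-Einstein fails at any point, for instance at r = 1, as an even rank is not 1. *)
  have Mp : M (const_mx 1) by rewrite /M /melvin_dom /= /rcoord mxE ltr01.
  by have := qe _ Mp; rewrite rank_ricci_melvin //; case: (_ == _); case: (_ == _).
- split=> [p Mp|]; first by rewrite ricci2_melvin // scaleNr subrr.
  (* Multiplying S^2 + lambda g = 0 by (4 + B0^2 r^2)^8 makes all coefficients polynomial in r. *)
  pose q : {poly R} := (4%:P + (B0 ^+ 2) *: 'X^2) ^+ 8.
  have qE p : q.[r p] = plus p ^+ 8.
    by rewrite /q horner_exp hornerD hornerC hornerZ hornerXn.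
  have r_period p : r (p + (2 * pi) *: delta_mx 0 3) = r p.
    by rewrite /r /rcoord !mxE mulr0 addr0.
  exists (fun=> - (2 ^+ 16 * B0 ^+ 4)), (fun=> 0), (fun p => q.[r p]); split.
  + split=> //; have := @smooth_on_poly R 4 M 1 (- (2 ^+ 16 * B0 ^+ 4))%:P.
    by under eq_fun do rewrite hornerC.
  + split=> //; have := @smooth_on_poly R 4 M 1 0.
    by under eq_fun do rewrite horner0.
  + split=> [|p Mp]; first exact: smooth_on_poly.
    by rewrite r_period.
  + move=> p Mp; have plus0 : plus p != 0 := melvin_plus_neq0 B0 (r p).
    rewrite qE expf_neq0 //; split=> //.
    rewrite ricci2_melvin // scale0r addr0 scalerA -scalerDl -[RHS](scale0r (g p)).
    by congr (_ *: _); rewrite -/(plus p); field.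
split=> [p Mp a b c x|B_neq0 comp]; first exact: riemann_compatible_melvin.
(* At a point with r = 1, the indices a = c = t and b = x = r give a nonzero sum. *)
have Mp : M (const_mx 1) by rewrite /M /melvin_dom /= /rcoord mxE ltr01.
have := comp _ Mp 0 1 0 1; rewrite projective_incompatible_melvin //.
apply/eqP; rewrite mulf_neq0 ?melvin_diag_neq0 // mulf_neq0 ?melvin_diag_neq0 //.
by rewrite mulf_neq0 ?expf_neq0 ?melvin_scale_neq0 // mulf_eq0 invr_eq0 !pnatr_eq0.
Qed.
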